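(* Assume that $q_i^x$ and $q_j^{y,i}$ both have property (D). Let $$v_{ij}^{\triangle,\mathcal N}(x,y)=j\,(\nabla f_i(x,y))\,g_{i,j}(x,y)-i\,f_i(x,y)\,\nabla g_{i,j}(x,y).$$ If $i+j\le p$ with $i\ge 2$, $j\ge 1$, then $v_{ij}^{\triangle,\mathcal N}\in R_{p-1}$.
   Context: For $m\in\mathbb N$, $\mathcal P_m$ denotes the real polynomials of (total) degree at most $m$. For $i\ge 2$ let $q_i^x\in\mathcal P_i\setminus\mathcal P_{i-1}$ be a univariate polynomial with $q_i^x(\pm1)=0$, and for $j\ge1$ let $q_j^{y,i}\in\mathcal P_j\setminus\mathcal P_{j-1}$ be a univariate polynomial with $q_j^{y,i}(-1)=0$ (the family may depend on $i$). A univariate polynomial $q$ of degree $n$ has property (D) if $\chi q'(\chi)-n\,q(\chi)=\tilde Q_{n-1}(\chi)$ for some polynomial $\tilde Q_{n-1}$ of degree at most $n-1$. Define $f_i(x,y)=q_i^x\!\left(\frac{2x}{1-y}\right)\left(\frac{1-y}{2}\right)^i$ and $g_{i,j}(x,y)=q_j^{y,i}(y)$; these are polynomials in $x,y$. The Nédélec space of first kind in two dimensions is $R_k=[\mathcal P_{k-1}]^2\oplus S_k$, where $S_k=\{p\in[\tilde{\mathcal P}_k]^2 : \vec r\cdot p=0\}$, $\vec r=(x,y)^\top$, and $[\tilde{\mathcal P}_k]^2$ is the space of vector fields on $\mathbb R^2$ whose components are homogeneous polynomials of total degree exactly $k$ (or zero). *)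

(* Defs.v *)
From HB Require Import structures.
From mathcomp Require Import all_boot all_order all_algebra.
From mathcomp Require Import reals.
From mathcomp Require Import mpoly.

Set Implicit Arguments.
Unset Strict Implicit.
Unset Printing Implicit Defensive.

Import Order.TTheory GRing.Theory Num.Theory.

Local Open Scope ring_scope.

Section Polynomials.
Variable R : numFieldType.

Definition uniP (m : nat) : {pred {poly R}} := [pred q : {poly R} | size q <= m.+1]%N.

Definition bivP (m : nat) : {pred {mpoly R[2]}} :=
  [pred f : {mpoly R[2]} | msize f <= m.+1]%N.

Definition propertyD (q : {poly R}) : Prop :=
  let n := (size q).-1 in
  exists2 Q : {poly R}, Q \in uniP n.-1 & 'X * q^`() - n%:R *: q = Q.

(* The bivariate polynomial (x, y) |-> q(y). *)
Definition in_y (q : {poly R}) : {mpoly R[2]} := (map_poly (@mpolyC 2 R) q).['X_ord_max].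

(* [f] is the polynomial given by q(2x/(1-y)) ((1-y)/2)^i.  This expression has
   no meaning at y = 1, hence the restriction; for deg q <= i such an [f] exists
   and is unique, see [collapsed_exists] and [collapsed_uniq]. *)
Definition collapsed (i : nat) (q : {poly R}) (f : {mpoly R[2]}) : Prop :=
  forall x y : R, y != 1 ->
    f.@[tnth [tuple x; y]] = q.[2 * x / (1 - y)] * ((1 - y) / 2) ^+ i.

Definition vfield := 'cV[{mpoly R[2]}]_2.

Definition grad (f : {mpoly R[2]}) : vfield := \col_k f^`M(k).

Definition position : vfield := \col_k 'X_k.

Definition dotp (u v : vfield) : {mpoly R[2]} := \sum_k u k 0 * v k 0.

Definition vecP (m : nat) (u : vfield) : Prop := forall k, u k 0 \in bivP m.

Definition nedelecS (k : nat) (s : vfield) : Prop :=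
  (forall l, s l 0 \is k.-homog) /\ dotp position s = 0.

(* Only meant for k >= 1, where the sum is direct: see [nedelecR_direct]. *)
Definition nedelecR (k : nat) (v : vfield) : Prop :=
  exists u s : vfield, [/\ vecP k.-1 u, nedelecS k s & v = u + s].

Lemma in_yE (q : {poly R}) (x y : R) : (in_y q).@[tnth [tuple x; y]] = q.[y].
Proof.
rewrite /in_y -(horner_map (meval (tnth [tuple x; y]))) /= mevalXU (tnth_nth 0) /=.
by congr _.[_]; apply/polyP => k; rewrite !coef_map /= mevalC.
Qed.

Lemma nedelecR_direct (k : nat) (u : vfield) :
  (0 < k)%N -> vecP k.-1 u -> nedelecS k u -> u = 0.
Proof.
case: k => // k _ hu [hs _]; apply/matrixP => l j; rewrite ord1 mxE.
apply/eqP/negPn/negP => nz; move: (hu l); rewrite inE /=.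
have := dhomog_mf (hs l) (mlead_supp nz) => /= e.
by rewrite -(mlead_deg nz) e ltnn.
Qed.

Lemma collapsed_exists (i : nat) (q : {poly R}) :
  q \in uniP i -> exists f, collapsed i q f.
Proof.
rewrite inE /= => hq.
exists (\sum_(l < i.+1) q`_l *: ('X_ord0 ^+ l * (2^-1 *: (1 - 'X_ord_max)) ^+ (i - l))).
move=> x y y1; rewrite raddf_sum (horner_coef_wide _ hq) mulr_suml /=.
apply: eq_bigr => -[l /= hl] _.
rewrite mevalZ mevalM !rmorphXn /= mevalZ mevalB meval1 !mevalXU !(tnth_nth 0) /=.
rewrite -mulrA; congr (_ * _).
have z : 1 - y != 0 by rewrite subr_eq0 eq_sym.
have z2 : (2 : R) != 0 by rewrite pnatr_eq0.
rewrite [_^-1 * _]mulrC.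
rewrite -[in RHS](subnKC (hl : l <= i)%N) exprD mulrA -exprMn; congr (_ ^+ _ * _).
by rewrite mulrA divfK // mulrAC divff // mul1r.
Qed.

Lemma muni_eq0 n (p : {mpoly R[n.+1]}) : muni p = 0 -> p = 0.
Proof.
move=> h; apply/mpolyP => m; rewrite mcoeff0.
pose w (m : 'X_{1..n.+1}) := [multinom m (widen_ord (leqnSn n) i) | i < n].
have : ((muni p)`_(m ord_max))@_(w m) = 0 by rewrite h coef0 mcoeff0.
rewrite muniE coef_sum raddf_sum /=.
under eq_bigr => m' _ do
  rewrite coefZ coefXn mulr_natr mcoeffMn mcoeffZ mcoeffX -mulrnAr.
have [mp|/memN_msupp_eq0 //] := boolP (m \in msupp p).
rewrite (bigD1_seq m) ?msupp_uniq //= !eqxx mulr1 big1 ?addr0 // => m' nm.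
case: eqP => [e1|]; last by rewrite mul0rn mulr0.
case: eqP => [e2|]; last by rewrite mulr0.
case/eqP: nm; apply/mnmP => j.
have [j' ->|->] := unliftP ord_max j; last by [].
have -> : lift ord_max j' = widen_ord (leqnSn n) j'.
  by apply: val_inj; rewrite /= /bump leqNgt ltn_ord.
by have /mnmP/(_ j') := e1; rewrite !mnmE.
Qed.

Lemma mpoly_eval0 n (p : {mpoly R[n]}) : (forall v, p.@[v] = 0) -> p = 0.
Proof.
elim: n p => [|n IH] p h.
  have /msize1_polyC e : (msize p <= 1)%N.
    by rewrite msizeE; apply/bigmax_leqP_seq => m _ _; rewrite mdegE big_ord0.
  have h0 : p@_0 = 0 by rewrite -(h (fun=> 0)) {2}e mevalC.
  by rewrite e h0 mpolyC0.
apply: muni_eq0; apply/polyP => k; rewrite coef0; apply: IH => w.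
suff /polyP/(_ k) : map_poly (meval w) (muni p) = 0 by rewrite coef_map coef0.
apply/eqP/negPn/negP => nz.
have /(max_poly_roots nz) : all (root (map_poly (meval w) (muni p)))
    [seq l%:R | l <- iota 0 (size (map_poly (meval w) (muni p)))].
  apply/allP => t _; apply/rootP.
  pose v (i : 'I_n.+1) := if unlift ord_max i is Some j then w j else t.
  rewrite -[RHS](h v) muniE raddf_sum horner_sum mevalE; apply: eq_bigr => m _ /=.
  rewrite map_polyZ map_polyXn /= hornerZ hornerXn mevalZ mevalX -mulrA.
  congr (_ * _); rewrite big_ord_recr /= /v unlift_none; congr (_ * _).
  apply: eq_bigr => j _; rewrite mnmE.
  have -> : widen_ord (leqnSn n) j = lift ord_max j.
    by apply: val_inj; rewrite /= /bump leqNgt ltn_ord.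
  by rewrite liftK.
rewrite size_map size_iota ltnn map_inj_uniq ?iota_uniq; first by move=> /(_ isT).
by move=> a b /eqP; rewrite eqr_nat => /eqP.
Qed.

Lemma collapsed_uniq (i : nat) (q : {poly R}) (f g : {mpoly R[2]}) :
  collapsed i q f -> collapsed i q g -> f = g.
Proof.
move=> hf hg; apply/eqP; rewrite -subr_eq0.
have nz : 1 - 'X_ord_max != 0 :> {mpoly R[2]}.
  apply/eqP => /(congr1 (meval (fun=> 0))).
  by rewrite mevalB meval1 mevalXU meval0 subr0 => /eqP; rewrite oner_eq0.
suff /eqP : (f - g) * (1 - 'X_ord_max) = 0 by rewrite mulf_eq0 (negPf nz) orbF.
apply: mpoly_eval0 => v.
rewrite mevalM !mevalB meval1 mevalXU.
have [->|hv] := eqVneq (v ord_max) 1; first by rewrite subrr mulr0.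
have e : v =1 tnth [tuple v ord0; v ord_max].
  by case=> -[|[|//]] h; rewrite (tnth_nth 0) /=; congr v; apply: val_inj.
by rewrite !(meval_eq _ e) hf // hg // subrr mul0r.
Qed.

End Polynomials.

(* Main.v *)
(** Write [r = (x, y)].  A field [v] of degree at most [k] lies in [R_k] as soon as
    [r . v] has degree at most [k]: its degree-[k] homogeneous part [s] then
    satisfies [r . s = 0], because [r . s] is the degree-[k+1] part of [r . v].
    For [v = j g grad f - i f grad g] with [deg f <= i] and [deg g <= j], Euler's
    identity shows that [r . grad f - i f] and [r . grad g - j g] lose one degree,
    hence so does [r . v = j g (r . grad f - i f) - i f (r . grad g - j g)]. *)

Require Import Defs.
From mathcomp Require Import all_boot all_order all_algebra.
From mathcomp Require Import reals.
From mathcomp Require Import mpoly.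
From mathcomp Require Import ring.

Import Order.TTheory GRing.Theory Num.Theory.

Local Open Scope ring_scope.

Section MpolyDegree.
Context {n : nat} {R : idomainType}.
Implicit Types p q : {mpoly R[n]}.

Lemma msizeD_leq p q d :
  (msize p <= d)%N -> (msize q <= d)%N -> (msize (p + q) <= d)%N.
Proof.
by move=> hp hq; apply: leq_trans (mmeasureD_le _ _ _) _; rewrite geq_max hp.
Qed.

Lemma msizeB_leq p q d :
  (msize p <= d)%N -> (msize q <= d)%N -> (msize (p - q) <= d)%N.
Proof. by move=> hp hq; apply: msizeD_leq; rewrite ?mmeasureN. Qed.

Lemma msizeZ_leq c p d : (msize p <= d)%N -> (msize (c *: p) <= d)%N.
Proof. exact/leq_trans/msizeZ_le. Qed.

Lemma msize_sum_leq (I : eqType) (r : seq I) (P : pred I) (F : I -> {mpoly R[n]}) d :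
  (forall i, i \in r -> P i -> (msize (F i) <= d)%N) ->
  (msize (\sum_(i <- r | P i) F i) <= d)%N.
Proof.
by move=> h; apply: leq_trans (mmeasure_sum _ _ _ _) _; apply/bigmax_leqP_seq.
Qed.

(** As [msize] is degree plus one, the bounds mean degree below [a] for [p] and at most [b] for [q].
    A zero factor is split off because [msizeM] needs nonzero factors. *)
Lemma msizeM_leq p q a b :
  (msize p <= a)%N -> (msize q <= b.+1)%N -> (msize (p * q) <= a + b)%N.
Proof.
have [->|p0] := eqVneq p 0; first by rewrite mul0r mmeasure0.
have [->|q0] := eqVneq q 0; first by rewrite mulr0 mmeasure0.
by move=> hp hq; rewrite msizeM // -ltnS -addnS prednK ?leq_add // addn_gt0
  lt0n msize_poly_eq0 p0.
Qed.

Lemma msizeX_leq p a k : (msize p <= a.+1)%N -> (msize (p ^+ k) <= (a * k).+1)%N.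
Proof.
move=> hp; elim: k => [|k IH]; first by rewrite muln0 expr0 msize1.
by rewrite exprS mulnS -addSn; apply: msizeM_leq.
Qed.

Lemma msize_mderiv p k d : (msize p <= d.+1)%N -> (msize p^`M(k) <= d)%N.
Proof.
move=> hp; rewrite msizeE; apply/bigmax_leqP_seq => m.
rewrite mcoeff_msupp mcoeff_deriv => hm _.
have : (m + U_(k))%MM \in msupp p.
  by rewrite mcoeff_msupp; apply: contraNneq hm => ->; rewrite mul0rn.
by move/msize_mdeg_lt/leq_trans/(_ hp); rewrite mdegD mdeg1 addn1.
Qed.

Lemma dhomog_msize_eq0 p d : p \is d.-homog -> (msize p <= d)%N -> p = 0.
Proof.
move=> /dhomogP hom hp; apply/eqP; apply: contraTT hp => nz.
by rewrite -ltnNge -mlead_deg // hom ?mlead_supp.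
Qed.

Lemma dhomog_msize_leq p d : p \is d.-homog -> (msize p <= d.+1)%N.
Proof.
by move=> /dhomogP hom; rewrite msizeE; apply/bigmax_leqP_seq => m /hom /= ->.
Qed.

(** In the partition of [p] into homogeneous components of degrees 0 to [d], the last summand is the
    one subtracted. *)
Lemma msize_sub_pihomog p d :
  (msize p <= d.+1)%N -> (msize (p - pihomog mdeg d p) <= d)%N.
Proof.
move=> hp; rewrite {1}(pihomog_partitionE hp) big_ord_recr /= addrK.
apply: msize_sum_leq => e _ _.
exact: leq_trans (dhomog_msize_leq _ _ (pihomogP _ _ _)) (ltn_ord e).
Qed.

(** The operator ['X_k * d/dX_k] multiplies a monomial by its exponent in ['X_k], and these
    exponents add up to the total degree. *)
Lemma mpoly_euler p :
  \sum_k 'X_k * p^`M(k) = \sum_(m <- msupp p) (p@_m * (mdeg m)%:R) *: 'X_[m].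
Proof.
rewrite {1}[p]mpolyE; under eq_bigr => k _ do rewrite raddf_sum mulr_sumr.
rewrite exchange_big; apply: eq_bigr => m _ /=.
rewrite mdegE natr_sum mulr_sumr scaler_suml; apply: eq_bigr => k _.
rewrite mderivZ mderivX -!scalerAr scalerA.
(* If [m k = 0], truncated subtraction of [U_(k)] cannot be undone, but the coefficient vanishes. *)
have [->|mk] := posnP (m k); first by rewrite mulr0 !scale0r.
by rewrite -mpolyXD addmC submK // lep1mP -lt0n.
Qed.

(** The coefficient at [m] is multiplied by [mdeg m - d], which kills exactly the terms of degree
    [d]. *)
Lemma msize_euler p d : (msize p <= d.+1)%N ->
  (msize ((\sum_k 'X_k * p^`M(k)) - d%:R *: p) <= d)%N.
Proof.
move=> hp; rewrite mpoly_euler {3}[p]mpolyE scaler_sumr -sumrB.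
apply: msize_sum_leq => m hm _; rewrite scalerA -scalerBl mulrC -mulrBl.
have := leq_trans (msize_mdeg_lt hm) hp; rewrite ltnS leq_eqVlt.
case/predU1P => [->|md]; first by rewrite subrr mul0r scale0r mmeasure0.
by apply: msizeZ_leq; rewrite msizeX.
Qed.

End MpolyDegree.

Section Nedelec.
Variable R : numFieldType.

(** The values of [f] off the line [y = 1] do not show its degree. By uniqueness [f] is the explicit
    sum [f'], whose terms have degree at most [l + (i - l) = i]. *)
Lemma collapsed_msize i (q : {poly R}) f :
  q \in uniP i -> collapsed i q f -> (msize f <= i.+1)%N.
Proof.
rewrite inE => hq hf.
pose h : {mpoly R[2]} := 2^-1 *: (1 - 'X_ord_max).
pose f' := \sum_(l < i.+1) q`_l *: ('X_ord0 ^+ l * h ^+ (i - l)).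
suff /collapsed_uniq/(_ hf) <- : collapsed i q f'.
  have hX k : (msize ('X_k : {mpoly R[2]}) <= 2)%N by rewrite msizeX mdeg1.
  have hh : (msize h <= 2)%N.
    by apply/msizeZ_leq/msizeB_leq => //; rewrite msize1.
  apply: msize_sum_leq => l _ _; apply: msizeZ_leq.
  rewrite -[X in (_ <= X.+1)%N](subnKC (ltn_ord l : l <= i)%N) -addSn.
  by apply: msizeM_leq; rewrite -[X in (_ <= X.+1)%N]mul1n; apply: msizeX_leq.
move=> x y y1; rewrite raddf_sum (horner_coef_wide _ hq) mulr_suml /=.
have z : 1 - y != 0 by rewrite subr_eq0 eq_sym.
apply: eq_bigr => l _.
rewrite mevalZ mevalM !rmorphXn /= mevalZ mevalB meval1 !mevalXU !(tnth_nth 0) /=.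
rewrite -[X in _ = _ * _ ^+ X](subnKC (ltn_ord l : l <= i)%N) exprD -!mulrA; congr (_ * _).
rewrite mulrA -exprMn; congr (_ ^+ _ * _ ^+ _); last exact: mulrC.
by field.
Qed.

Lemma in_y_msize j (q : {poly R}) : q \in uniP j -> (msize (in_y q) <= j.+1)%N.
Proof.
rewrite inE => hq; rewrite /in_y horner_coef.
apply: msize_sum_leq => l _ _; rewrite coef_map /= mul_mpolyC; apply: msizeZ_leq.
have hX : (msize ('X_ord_max : {mpoly R[2]}) <= 2)%N by rewrite msizeX mdeg1.
apply: leq_trans (msizeX_leq _ _ l hX) _; rewrite mul1n.
exact: leq_trans (ltn_ord l) (leq_trans (size_poly _ _) hq).
Qed.

Lemma dotpB (u v w : vfield R) : dotp u (v - w) = dotp u v - dotp u w.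
Proof. by rewrite -sumrB; apply: eq_bigr => k _; rewrite !mxE mulrBr. Qed.

Lemma nedelecR_degP k (v : vfield R) : (0 < k)%N -> vecP k v ->
  dotp (position R) v \in bivP k -> nedelecR k v.
Proof.
move=> k0 hv hr; pose s : vfield R := \col_l pihomog mdeg k (v l 0).
have hs l : s l 0 \is k.-homog by rewrite mxE pihomogP.
have hu l : (msize ((v - s) l 0%R) <= k)%N by rewrite !mxE; exact/msize_sub_pihomog/hv.
exists (v - s), s; split; last by rewrite subrK.
  by move=> l; rewrite inE prednK.
(* The product [r . s] is homogeneous of degree [k + 1], and [r . s = r . v - r . (v - s)] has
   degree at most [k], so it is zero. *)
split=> //; apply: (@dhomog_msize_eq0 _ _ _ k.+1).
  apply: rpred_sum => l _; rewrite [position R _ _]mxE -[k.+1]add1n.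
  by apply: dhomogM (hs l); rewrite dhomogX /= mdeg1.
rewrite -[s](subKr v) dotpB; apply: msizeB_leq => //.
apply: msize_sum_leq => l _ _; rewrite mulrC -[k.+1]addn1.
by apply: msizeM_leq (hu l) _; rewrite mxE msizeX mdeg1.
Qed.

Lemma dotp_position_grad (f : {mpoly R[2]}) :
  dotp (position R) (grad f) = \sum_k 'X_k * f^`M(k).
Proof. by apply: eq_bigr => k _; rewrite !mxE. Qed.

Lemma nedelecR_wronskian i j k (f g : {mpoly R[2]}) :
  (0 < i)%N -> (0 < j)%N -> (i + j <= k.+1)%N ->
  (msize f <= i.+1)%N -> (msize g <= j.+1)%N ->
  nedelecR k (j%:R *: (g *: grad f) - i%:R *: (f *: grad g)).
Proof.
move=> i0 j0 ijk hf hg; apply: nedelecR_degP.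
- by rewrite -ltnS (leq_trans _ ijk) // -addn1 leq_add.
(* Each product contains one derivative, so its degree is at most [i + j - 1]. *)
- move=> l; rewrite inE (leq_trans _ ijk) // !mxE -!scaler_nat -!scalerAl !mul1r.
  apply: msizeB_leq; apply: msizeZ_leq.
    by rewrite mulrC; apply: msizeM_leq => //; apply: msize_mderiv.
  by rewrite mulrC addnC; apply: msizeM_leq => //; apply: msize_mderiv.
rewrite inE (leq_trans _ ijk) //.
(* The two corrections [i * j * f * g] introduced here cancel. *)
suff -> : dotp (position R) (j%:R *: (g *: grad f) - i%:R *: (f *: grad g)) =
    j%:R *: (((\sum_k 'X_k * f^`M(k)) - i%:R *: f) * g) -
    i%:R *: (((\sum_k 'X_k * g^`M(k)) - j%:R *: g) * f).
  apply: msizeB_leq; apply: msizeZ_leq; last rewrite addnC;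
    by apply: msizeM_leq => //; apply: msize_euler.
rewrite /dotp -!dotp_position_grad /dotp !big_ord_recr !big_ord0 /= !mxE.
rewrite !scaler_nat; ring.
Qed.

End Nedelec.

Theorem theorem3p1 (R : realType)
  (qx : nat -> {poly R}) (qy : nat -> nat -> {poly R})
  (hqx : forall i : nat, (2 <= i)%N ->
     [/\ qx i \in uniP i, qx i \notin uniP i.-1,
         (qx i).[1] = 0 & (qx i).[-1] = 0])
  (hqy : forall i j : nat, (2 <= i)%N -> (1 <= j)%N ->
     [/\ qy i j \in uniP j, qy i j \notin uniP j.-1 & (qy i j).[-1] = 0])
  (f : nat -> {mpoly R[2]})
  (hf : forall i : nat, (2 <= i)%N -> collapsed i (qx i) (f i))
  (i j p : nat) (hi : (2 <= i)%N) (hj : (1 <= j)%N) (hp : (i + j <= p)%N)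
  (hDx : propertyD (qx i)) (hDy : propertyD (qy i j)) :
  let g := in_y (qy i j) in
  nedelecR p.-1 (j%:R *: (g *: grad (f i)) - i%:R *: (f i *: grad g)).
Proof.
move=> g; have [hqi _ _ _] := hqx _ hi; have [hqj _ _] := hqy _ _ hi hj.
have i0 := ltnW hi.
apply: nedelecR_wronskian => //.
(* Since [0 < i + j <= p], the successor of [p.-1] is [p]. *)
- by rewrite prednK // (leq_trans _ hp) // addn_gt0 i0.
- exact: collapsed_msize (hf _ hi).
- exact: in_y_msize.
Qed.
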